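(* (Stone–Weierstrass for unital Abelian $\ell$-groups.) Let $(X,\zeta)$ be a compact a-space, let $G$ be a unital $\ell$-subgroup of $\mathrm{C_a}(X)$, and suppose that: (1) for every $x\neq y$ in $X$ there exists $g\in G$ such that $g(x)\neq g(y)$; (2) for every $x\in X$, $\zeta(x)=\operatorname{lcm}\{\operatorname{den}(g(x))\mid g\in G\}$. Then $G$ is dense in $\mathrm{C_a}(X)$ with respect to the uniform metric.
   Context: $\mathbb{N}=\{0,1,2,\dots\}$ is ordered by divisibility ($0$ is the top element, $1$ the bottom); $\operatorname{lcm}$ of a possibly infinite subset of $\mathbb{N}$ is its supremum in this order (so it is $0$ if there is no positive common multiple). $\mathbb{N}$ carries the upper topology of the divisibility order: the sets $\{m\in\mathbb{N}\mid m \text{ divides } n\}$, $n\in\mathbb{N}$, form a subbasis for the closed sets. An a-space $(X,\zeta)$ is a topological space $X$ with a continuous function $\zeta\colon X\to\mathbb{N}$; it is compact if $X$ is compact. An a-map $f\colon (X,\zeta)\to(X',\zeta')$ is a continuous map such that $\zeta'(f(x))$ divides $\zeta(x)$ for all $x\in X$. For $p/q\in\mathbb{Q}$ with $p\in\mathbb{Z}$, $q\geq 1$ coprime, $\operatorname{den}(p/q)=q$; for irrational $r$, $\operatorname{den}(r)=0$; $\mathbb{R}$ with the Euclidean topology and $\operatorname{den}$ is an a-space. $\mathrm{C_a}(X)$ is the unital Abelian $\ell$-group (lattice-ordered group) of a-maps $X\to(\mathbb{R},\operatorname{den})$ with pointwise operations and unit the constant function $1$. A unital $\ell$-subgroup is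 a subgroup that is also a sublattice and contains the unit. The uniform metric is the metric of the sup norm. *)

(* Defs.v *)
From HB Require Import structures.
From mathcomp Require Import all_boot all_order all_algebra finmap.
From mathcomp Require Import all_classical all_reals all_analysis.

Set Implicit Arguments.
Unset Strict Implicit.
Unset Printing Implicit Defensive.

Import Order.TTheory GRing.Theory Num.Theory.
Import numFieldNormedType.Exports.

Local Open Scope classical_set_scope.
Local Open Scope ring_scope.

(* [natdvd] is [nat] ordered by divisibility ([(m <= n)%O] is [m %| n]), with
   bottom 1 and top 0. Its upper topology is generated by the complements of
   the sets [{m | m divides n}]. *)
HB.instance Definition _ := @isSubBaseTopological.Build natdvd
  nat [set: nat] (fun n => ~` [set m : natdvd | (m %| n)%N]).

Lemma continuous_natdvd (X : topologicalType) (f : X -> natdvd) :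
  (forall n : nat, closed [set x | (f x %| n)%N]) -> continuous f.
Proof.
move=> Hf x A /=; rewrite (@nbhsE natdvd).
move=> [_ [[B sB <-] [C BC Ct] sUBA]].
rewrite nbhs_filterE; apply: filterS sUBA _; apply: (@filterS _ _ _ C).
  by move=> ? ?; exists C.
have /sB [D _ IDeC] := BC; rewrite -IDeC.
change (nbhs (f @ x) (\bigcap_(i in [set` D])
  ~` [set m : natdvd | (m %| i)%N])).
apply: filter_bigI => i Di.
have : ~ (f x %| i)%N.
  by move: Ct; rewrite -IDeC => /(_ i Di).
move=> fxi; have := closed_openC (Hf i); rewrite openE => /(_ x fxi).
by rewrite /interior.
Qed.

(* The value of [supremum] on [set0] is its first argument; the supremum of
   [set0] for divisibility is the bottom element 1. *)
Definition lcm_set (A : set natdvd) : natdvd := supremum (1%N : natdvd) A.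

Lemma lcm_set_isLub (A : set natdvd) : isLub A (lcm_set A).
Proof.
suff [l lA] : supremums A !=set0.
  rewrite /lcm_set /supremum; case: ifPn => [/eqP ->|_].
    by split => [?|b _] //; exact: dvd1n.
  by case: xgetP => [y _ [yA yl]|/(_ l)].
have [[m m0 mA]|noub] :=
    pselect (exists2 m : nat, (0 < m)%N & ubound A (m : natdvd)); last first.
  exists 0%N; split=> [a _|b bA]; first exact: dvdn0.
  rewrite Order.NatDvd.dvdE; case: b bA => // b bA.
  by exfalso; apply: noub; exists b.+1.
have exP : exists m, (0 < m)%N && `[< ubound A (m : natdvd) >].
  by exists m; rewrite m0; apply/asboolP.
case: (ex_minnP exP) => l /andP[l0 /asboolP lA] lmin.
exists l; split => // b bA.
rewrite Order.NatDvd.dvdE.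
have gA : ubound A (gcdn l b : natdvd).
  move=> a Aa; rewrite Order.NatDvd.dvdE dvdn_gcd.
  by have := lA a Aa; have := bA a Aa; rewrite !Order.NatDvd.dvdE => -> ->.
have := lmin (gcdn l b); rewrite gcdn_gt0 l0 /= => /(_ (introT (asboolP _) gA)).
move=> lg; have: gcdn l b = l.
  by apply/eqP; rewrite eqn_leq lg dvdn_leq// dvdn_gcdl.
by move=> <-; exact: dvdn_gcdr.
Qed.

Record aspace := Aspace {
  aspace_sort :> topologicalType;
  zeta : aspace_sort -> natdvd;
  zeta_continuous : continuous zeta }.

Arguments zeta {_} _.

Definition amap (X Y : aspace) (f : X -> Y) : Prop :=
  continuous f /\ forall x, (zeta (f x) %| zeta x)%N.

Section den.
Variable R : realType.
Implicit Types x y : R.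

Definition den x : natdvd :=
  if x \in rational then absz (denq (xget 0 [set q : rat | ratr q = x]))
  else 0%N.

Lemma den_ratr (q : rat) : den (ratr q) = `|denq q|%N.
Proof.
rewrite /den mem_set; last by exists q.
by case: xgetP => [r _ /= /fmorph_inj -> //|/(_ q)/=]; tauto.
Qed.

Lemma den_irrational x : irrational x -> den x = 0%N.
Proof. by move=> xI; rewrite /den memNset. Qed.

Lemma den_dvdn x (n : nat) : (0 < n)%N ->
  (den x %| n)%N <-> (n%:R * x \is a Num.int).
Proof.
move=> n0; have n0R : n%:R != 0 :> R by rewrite pnatr_eq0 -lt0n.
have [[q _ <-]|xI] := pselect (rational x); last first.
  rewrite den_irrational// dvd0n eqn0Ngt n0; split=> // /intrP[k kE].
  exfalso; apply: xI; apply/rationalP; exists k, n.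
  by rewrite -kE mulrAC divff// mul1r.
rewrite den_ratr.
have -> : (n%:R * ratr q : R) = ratr (n%:R * q) by rewrite rmorphM/= ratr_nat.
split.
  move=> /dvdnP[k ->]; apply/intrP; exists (k%:Z * numq q).
  rewrite -(ratr_int R); congr ratr.
  rewrite natrM natr_absz ger0_norm ?denq_ge0// intrM numqE.
  by rewrite -mulrA; congr (_ * _); exact: mulrC.
move=> /intrP[k]; rewrite -(ratr_int R) => /fmorph_inj nqk.
have : (denq q %| n%:Z * numq q)%Z.
  apply/dvdzP; exists k; apply: (@intr_inj rat).
  by rewrite !intrM -nqk numqE mulrA.
by rewrite Gauss_dvdzl ?dvdzE// coprimezE coprime_sym coprime_num_den.
Qed.

Lemma closed_int : closed [set x : R | x \is a Num.int].
Proof.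
rewrite -[X in closed X]setCK; apply: open_closedC; rewrite openE => x /negP xI.
rewrite /interior.
have [l u] : (Num.floor x)%:~R < x /\ x < (Num.floor x + 1)%:~R.
  split; last exact: floorD1_gt.
  rewrite lt_neqAle floor_le_tmp andbT; apply: contra xI => /eqP <-.
  exact: intr_int.
near=> y => /= /intrP[k yk].
have : (Num.floor x < k)%R by rewrite -(ltr_int R) -yk;
  near: y; exact: lt_nbhsr.
have : (k < Num.floor x + 1)%R by rewrite -(ltr_int R) -yk;
  near: y; exact: lt_nbhsl.
by rewrite ltzD1 => /le_lt_trans h /h; rewrite ltxx.
Unshelve. all: by end_near. Qed.

Lemma den_continuous : continuous den.
Proof.
apply: continuous_natdvd => -[|n].
  by rewrite (_ : [set _ | _] = setT) //; apply/seteqP; split=> // x _ /=.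
rewrite (_ : [set _ | _] =
    (fun x => n.+1%:R * x) @^-1` [set x : R | x \is a Num.int]); last first.
  by apply/seteqP; split=> x /= /den_dvdn; exact.
apply: closed_comp; last exact: closed_int.
by move=> x _; exact: mulrl_continuous.
Qed.

Definition real_aspace : aspace := @Aspace R den den_continuous.

End den.

Section Ca.
Variables (R : realType) (X : aspace).

Definition Ca : set (X -> R) := [set f | @amap X (real_aspace R) f].

(* The lattice operations [\min] and [\max] are pointwise. *)
Record unital_lsubgroup (G : set (X -> R)) : Prop := {
  lsubgroup_Ca : G `<=` Ca;
  lsubgroup0 : G (cst 0);
  lsubgroupD : forall f g, G f -> G g -> G (f \+ g);
  lsubgroupN : forall f, G f -> G (\- f);
  lsubgroup_min : forall f g, G f -> G g -> G (f \min g);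
  lsubgroup_max : forall f g, G f -> G g -> G (f \max g);
  lsubgroup1 : G (cst 1) }.

Lemma Ca_unital_lsubgroup : unital_lsubgroup Ca.
Proof.
have denP x y : (den (y : R) %| zeta (x : X))%N <->
    (zeta x == 0%N :> nat) || ((zeta x : nat)%:R * y \is a Num.int).
  by case: (zeta x) => [|n] /=; [rewrite dvdn0|exact: den_dvdn].
split => //.
- split=> [|x]; first exact: cst_continuous.
  by apply/denP; rewrite /= mulr0 rpred0 orbT.
- move=> f g [cf df] [cg dg]; split=> [x|x].
    exact: (@continuousD _ R^o X f g x (cf x) (cg x)).
  move: (df x) (dg x) => /denP + /denP; case/orP => [x0|If].
    by move=> _; apply/denP; rewrite x0.
  case/orP => [x0|Ig]; apply/denP; first by rewrite x0.
  by rewrite /= mulrDr rpredD ?orbT.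
- move=> f [cf df]; split=> [x|x].
    exact: (@continuousN _ R^o X f x (cf x)).
  move: (df x) => /denP /orP[x0|If]; apply/denP; first by rewrite x0.
  by rewrite /= mulrN rpredN If orbT.
- move=> f g [cf df] [cg dg]; split=> [x|x].
    exact: (@continuous_min R X f g x (cf x) (cg x)).
  by rewrite /= /Order.min; case: ifP => _; [exact: df|exact: dg].
- move=> f g [cf df] [cg dg]; split=> [x|x].
    exact: (@continuous_max R X f g x (cf x) (cg x)).
  by rewrite /= /Order.max; case: ifP => _; [exact: dg|exact: df].
- split=> [|x]; first exact: cst_continuous.
  by apply/denP; rewrite /= mulr1 rpred_nat orbT.
Qed.

(* [sup] takes the value 0 on empty and on unbounded sets. Continuous functions
   on a compact space are bounded, and on the empty space the norm is 0. *)
Definition sup_norm (f : X -> R) : R := sup [set `|f x| | x in [set: X]].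

Definition uniform_dist (f g : X -> R) : R := sup_norm (f \- g).

Definition uniformly_dense (G : set (X -> R)) : Prop :=
  forall f, Ca f -> forall e : R, 0 < e ->
    exists2 g, G g & uniform_dist f g < e.

End Ca.

Arguments Ca : clear implicits.

(* Main.v *)
Require Import Defs.
From mathcomp Require Import all_boot all_order all_algebra.
From mathcomp Require Import all_classical all_reals all_analysis.
From mathcomp Require Import lra.

(** The proof is Stone's: a sublattice of continuous functions on a compact
    space approximates uniformly every continuous function that it approximates
    on each pair of points ([lattice_approximation]).  It remains to describe
    the pairs [(g x, g y)] with [g] in [G].

    At one point [x], the values of [G] form a subgroup of the reals that
    contains 1.  If it is not dense, it is generated by some [1 / k]; then every
    value has a denominator dividing [k], hence so does [zeta x], and the group
    contains every real number whose denominator divides [zeta x].  In both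
    cases each [r] with [den r] dividing [zeta x] is a limit of values
    ([values_approximate]).

    At two distinct points the values are independent: an element of [G] that
    separates [x] and [y] can be moved by integer multiples and integer
    translations, then truncated below at 0, to vanish at [x] and be as large as
    needed at [y] ([vanishing_large]).  Truncating a difference [h - g] between
    such a function and its opposite gives an element of [G] that vanishes at
    [x] and equals [h - g] at [y], so [g] at [x] and [h] at [y] are joined by a
    single element of [G] ([interpolate_two_points]).  Only
    integer multiples and integer constants enter these constructions, so a
    group containing 1 suffices where the classical theorem uses real scalars. *)

Set Implicit Arguments.
Unset Strict Implicit.
Unset Printing Implicit Defensive.

Import Order.TTheory GRing.Theory Num.Theory.
Import numFieldNormedType.Exports.

Local Open Scope classical_set_scope.

(** * Subgroups of the reals *)

Section RealSubgroup.
Local Open Scope ring_scope.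
Variables (R : realType) (A : set R).
Hypotheses (A1 : A 1) (AB : forall a b, A a -> A b -> A (a - b)).

Lemma subgroup0 : A 0.
Proof. by rewrite -(subrr 1); exact: AB. Qed.

Lemma subgroupN a : A a -> A (- a).
Proof. by move=> Aa; rewrite -sub0r; apply: AB => //; exact: subgroup0. Qed.

Lemma subgroupMz a (z : int) : A a -> A (z%:~R * a).
Proof.
move=> Aa; have An n : A (n%:R * a).
  elim: n => [|n IHn]; first by rewrite mul0r; exact: subgroup0.
  rewrite (_ : _ * a = n%:R * a - - a); last first.
    by rewrite opprK -[n.+1]addn1 natrD mulrDl mul1r.
  by apply: AB => //; exact: subgroupN.
case: (intP z) => [|n|n]; first by rewrite mul0r; exact: subgroup0.
  exact: An.
by rewrite mulrNz mulNr; apply/subgroupN/An.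
Qed.

Lemma subgroup_modz a b : A a -> A b -> 0 < a ->
  exists2 z : int, A (b - z%:~R * a) & 0 <= b - z%:~R * a < a.
Proof.
move=> Aa Ab a0; exists (Num.floor (b / a)).
  by apply: AB => //; exact: subgroupMz.
have /andP[] := floor_itv (b / a).
rewrite ler_pdivlMr// ltr_pdivrMr// intrD mulrDl mul1r => h1 h2.
by apply/andP; split; lra.
Qed.

(** Without arbitrarily small positive elements, the infimum of the positive
    elements is positive and generates the group: were it not attained, two
    distinct positive elements close to it would have too small a
    difference. *)
Lemma subgroup_dense_or_cyclic :
  (forall e, 0 < e -> exists2 a, A a & 0 < a < e) \/
  (exists a, [/\ A a, 0 < a & forall b, A b -> exists z : int, b = z%:~R * a]).
Proof.
have [dA|ndA] := pselect (forall e, 0 < e -> exists2 a, A a & 0 < a < e).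
  by left.
right.
have [d d0 Ad] : exists2 d, 0 < d & forall a, A a -> 0 < a -> d <= a.
  apply: contrapT => nd; apply: ndA => e e0; apply: contrapT => nA.
  apply: nd; exists e => // a Aa a0; rewrite leNgt; apply/negP => ae.
  by apply: nA; exists a => //; rewrite a0.
pose P := [set a | A a /\ 0 < a].
have infP : has_inf P by split; [exists 1|exists d => a [Aa a0]; exact: Ad].
have infle a : A a -> 0 < a -> inf P <= a.
  by move=> Aa a0; apply: ge_inf => //; exact: infP.2.
have [b [Ab b0] binf] := inf_adherent d0 infP.
have bmin c : A c -> 0 < c -> b <= c.
  move=> Ac c0; rewrite leNgt; apply/negP => cb.
  have := Ad _ (AB Ab Ac); rewrite subr_gt0 => /(_ cb).
  by have := infle c Ac c0; lra.
exists b; split => // c Ac.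
have [z Az /andP[z0 zb]] := subgroup_modz Ab Ac b0.
exists z; apply/eqP; rewrite -subr_eq0 eq_le z0 andbT leNgt; apply/negP => zp.
by have := bmin _ Az zp; lra.
Qed.

(** With arbitrarily small positive elements, multiples of one of them come
    close to [r].  In the cyclic case the generator is [1 / k], and [k] is a
    common multiple of the denominators, so [r] itself is in the group. *)
Lemma subgroup_approximates r :
  (den r %| lcm_set [set den a | a in A])%N ->
  forall e, 0 < e -> exists2 a, A a & `|a - r| < e.
Proof.
move=> rA e e0; have [/(_ e e0)[a Aa /andP[a0 ae]]|] := subgroup_dense_or_cyclic.
  exists ((Num.floor (r / a))%:~R * a); first exact: subgroupMz.
  have /andP[] := floor_itv (r / a).
  rewrite ler_pdivlMr// ltr_pdivrMr// intrD mulrDl mul1r => h1 h2.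
  by rewrite ltr_norml; apply/andP; split; lra.
move=> [a [Aa a0 Agen]].
have [k ka] : exists k : nat, 1 = k%:R * a.
  have [z za] := Agen _ A1; case: (intP z) za => [|n|n] za.
  - by exists 0%N.
  - by exists n.+1.
  - exfalso; have: n.+1%:R * a > 0 by rewrite mulr_gt0.
    by move: za; rewrite mulrNz mulNr -pmulrn; lra.
have k0 : (0 < k)%N.
  by rewrite lt0n; apply/eqP => kE; move: ka; rewrite kE mul0r => /eqP;
    rewrite oner_eq0.
have lcmk : (lcm_set [set den b | b in A] %| k)%N.
  have [_ /(_ (k : natdvd))] := lcm_set_isLub [set den b | b in A].
  rewrite Order.NatDvd.dvdE; apply => _ [b Ab <-].
  rewrite Order.NatDvd.dvdE; apply/den_dvdn => //.
  have [z ->] := Agen _ Ab.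
  by rewrite mulrCA -ka mulr1 intr_int.
have /(den_dvdn _ k0)/intrP[z zE] := dvdn_trans rA lcmk.
exists r; last by rewrite subrr normr0.
have -> : r = z%:~R * a by rewrite -zE mulrAC -ka mul1r.
exact: subgroupMz.
Qed.

End RealSubgroup.

(** * Lattices of continuous functions on a compact space *)

Section CompactLattice.
Local Open Scope ring_scope.

(** Otherwise the complements of the sets satisfying [P] form a proper filter,
    and a cluster point of it has no neighbourhood satisfying [P]. *)
Lemma compact_set_ind (T : topologicalType) (P : set T -> Prop) :
  compact [set: T] -> P set0 -> (forall U V, U `<=` V -> P V -> P U) ->
  (forall U V, P U -> P V -> P (U `|` V)) ->
  (forall x : T, exists2 U, nbhs x U & P U) -> P [set: T].
Proof.
move=> cT P0 Psub PU Ploc; apply: contrapT => nPT.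
pose F : set_system T := [set U | P (~` U)].
have FF : ProperFilter F.
  split; first by rewrite /F /= setC0.
  split; first by rewrite /F /= setCT.
    by move=> U V; rewrite /F /= setCI; exact: PU.
  by move=> U V UV; apply: Psub; exact: subsetC.
have [|x [_ clx]] := cT F FF; first by rewrite /F /= setCT.
have [U xU PxU] := Ploc x.
by have [|y []] := clx (~` U) U _ xU; first by rewrite /F /= setCK.
Qed.

Variables (R : realType) (X : topologicalType).
Hypothesis cptX : compact [set: X].

(** The set of points where some [g] in [L] lies below [f] grows with finite
    minima, so compactness makes it everything. *)
Lemma min_closed_below (L : set (X -> R)) (f : X -> R) :
  L !=set0 -> (forall g h, L g -> L h -> L (g \min h)) ->
  continuous f -> (forall g, L g -> continuous g) ->
  (forall x, exists2 g, L g & g x < f x) ->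
  exists2 g, L g & forall x, g x < f x.
Proof.
move=> [g0 Lg0] Lmin cf cL Lf.
suff [g Lg gf] : exists2 g, L g & forall x, [set: X] x -> g x < f x.
  by exists g => // x; exact: gf.
apply: (@compact_set_ind _ (fun U => exists2 g, L g & forall x, U x -> g x < f x)).
- exact: cptX.
- by exists g0.
- by move=> U V UV [g Lg gV]; exists g => // x /UV; exact: gV.
- move=> U V [g Lg gU] [h Lh hV]; exists (g \min h); first exact: Lmin.
  by move=> x [/gU|/hV] ?; rewrite /= gt_min; apply/orP; [left|right].
move=> x; have [g Lg gfx] := Lf x; exists [set y | g y < f y]; last by exists g.
have cfg : {for x, continuous (f \- g)}.
  by apply: (@continuousB _ R^o X f g x); [exact: cf|exact: cL].
have : \forall y \near x, 0 < (f \- g) y.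
  by apply: (cvgr_gt _ cfg); rewrite subr_gt0.
by apply: filterS => y /=; rewrite subr_gt0.
Qed.

(** Stone's two-step argument: first a finite minimum lies below [f + e] while
    staying above [f - e] at a given point, then a finite maximum of such
    minima lies above [f - e] everywhere.  The second step is the first one
    applied to the opposites. *)
Lemma lattice_approximation (L : set (X -> R)) (f : X -> R) (e : R) :
  L !=set0 -> (forall g h, L g -> L h -> L (g \min h)) ->
  (forall g h, L g -> L h -> L (g \max h)) ->
  continuous f -> (forall g, L g -> continuous g) ->
  (forall x y, exists2 g, L g & `|g x - f x| < e /\ `|g y - f y| < e) ->
  exists2 g, L g & forall x, `|g x - f x| < e.
Proof.
move=> [g0 Lg0] Lmin Lmax cf cL Lxy.
have cfe (d : R) : continuous (fun x => f x + d).
  by move=> x; apply: (@continuousD _ R^o X f (cst d) x);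
    [exact: cf|exact: cst_continuous].
have below x : exists2 g, L g /\ f x - e < g x & forall y, g y < f y + e.
  apply: (@min_closed_below [set g | L g /\ f x - e < g x]) => //.
  - have [g Lg [gx _]] := Lxy x x; exists g; split => //.
    by move: gx; rewrite ltr_norml => /andP[]; lra.
  - by move=> g h [Lg gx] [Lh hx]; split; [exact: Lmin|rewrite /= lt_min gx].
  - by move=> g [/cL].
  - move=> y; have [g Lg [gx gy]] := Lxy x y; exists g; first split => //.
      by move: gx; rewrite ltr_norml => /andP[]; lra.
    by move: gy; rewrite ltr_norml => /andP[]; lra.
pose L' := [set h : X -> R | L (\- h) /\ forall y, - h y < f y + e].
have oppL' g : L g -> (forall y, g y < f y + e) -> L' (\- g).
  move=> Lg gf; split=> [|y /=]; last by rewrite opprK.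
  by rewrite (_ : \- (\- g) = g)//; apply/funext => y /=; rewrite opprK.
have [|||||h [Lh hf] fh] := @min_closed_below L' (fun x => - f x + e).
- have [[x _]|X0] := pselect ([set: X] !=set0).
    by have [g [Lg _] gf] := below x; exists (\- g); exact: oppL'.
  by exists (\- g0); apply: oppL' => // y; exfalso; apply: X0; exists y.
- move=> g h [Lg gf] [Lh hf]; split.
    rewrite (_ : \- (g \min h) = (\- g) \max (\- h)); first exact: Lmax.
    by apply/funext => y /=; rewrite oppr_min.
  by move=> y /=; rewrite oppr_min gt_max gf hf.
- move=> x; apply: (@continuousD _ R^o X (\- f) (cst e) x).
    by apply: (@continuousN _ R^o X f x); exact: cf.
  exact: cst_continuous.
- move=> h [Lh _] x; rewrite (_ : h = \- (\- h)); last first.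
    by apply/funext => y /=; rewrite opprK.
  by apply: (@continuousN _ R^o X (\- h) x); exact: cL.
- move=> x; have [g [Lg gx] gf] := below x.
  by exists (\- g); [exact: oppL'|rewrite /=; lra].
exists (\- h) => // x; have := hf x; have := fh x.
by rewrite ltr_norml /= => ? ?; apply/andP; split; lra.
Qed.

End CompactLattice.

(** * Values of a unital lattice-ordered group of a-maps *)

Section Values.
Local Open Scope ring_scope.
Variables (R : realType) (X : aspace) (G : set (X -> R)).
Hypothesis GC : unital_lsubgroup G.

Lemma lsubgroupMn (g : X -> R) (n : nat) : G g -> G (fun x => n%:R * g x).
Proof.
move=> Gg; elim: n => [|n IHn].
  rewrite (_ : (fun _ => _) = cst 0); first exact: (lsubgroup0 GC).
  by apply/funext => x; rewrite mul0r.
rewrite (_ : (fun _ => _) = g \+ (fun x => n%:R * g x)).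
  exact: (lsubgroupD GC).
by apply/funext => x /=; rewrite -[n.+1]add1n natrD mulrDl mul1r.
Qed.

Lemma lsubgroup_int (z : int) : G (cst z%:~R).
Proof.
have Gn n : G (cst n%:R).
  rewrite (_ : cst _ = fun x => n%:R * cst 1 x).
    by apply: lsubgroupMn; exact: (lsubgroup1 GC).
  by apply/funext => x /=; rewrite mulr1.
case: (intP z) => [|n|n]; [exact: Gn 0%N|exact: Gn|].
rewrite (_ : cst _ = \- (cst n.+1%:R)); first exact: (lsubgroupN GC).
by apply/funext => x /=; rewrite mulrNz.
Qed.

Lemma values_approximate (x : X) (r : R) :
  zeta x = lcm_set [set den (g x) | g in G] -> (den r %| zeta x)%N ->
  forall e, 0 < e -> exists2 g, G g & `|g x - r| < e.
Proof.
move=> xE rx e e0.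
have [||| _ [g Gg <-] gr] := @subgroup_approximates R [set g x | g in G] _ _ r _ e e0.
- by exists (cst 1) => //; exact: (lsubgroup1 GC).
- move=> _ _ [g Gg <-] [h Gh <-]; exists (g \+ (\- h)) => //.
  by apply: (lsubgroupD GC) => //; exact: (lsubgroupN GC).
- by move: rx; rewrite xE -(image_comp (fun g => g x) (@den R) G).
- by exists g.
Qed.

(** A rational number strictly between [u x] and [u y] turns the separating
    function [u] into one with a negative value at [x] and a positive value at
    [y]. *)
Lemma vanishing_large (x y : X) (t : R) :
  (exists2 u, G u & u x <> u y) ->
  exists2 p, G p & p x = 0 /\ t <= p y.
Proof.
move=> [u0 Gu0 /eqP u0xy].
have [u Gu uxy] : exists2 u, G u & u x < u y.
  move: u0xy; rewrite neq_lt => /orP[|] lt0; first by exists u0.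
  by exists (\- u0); [exact: (lsubgroupN GC)|rewrite /= ltrN2].
have [q] := rat_in_itvoo uxy; rewrite in_itv/= => /andP[xq qy].
pose n : R := `|denq q|%N%:R.
have n0 : 0 < n by rewrite ltr0n absz_gt0 denq_eq0.
have nq : (numq q)%:~R = n * ratr q.
  have dE : n = (denq q)%:~R :> R.
    by rewrite /n natr_absz ger0_norm ?denq_ge0.
  by rewrite /ratr dE mulrC divfK// intr_eq0 denq_eq0.
pose v z := n * u z + - (numq q)%:~R.
have Gv : G v.
  apply: (lsubgroupD GC (lsubgroupMn _ Gu)).
  by apply: (lsubgroupN GC); exact: lsubgroup_int.
have vE z : v z = n * (u z - ratr q) by rewrite /v nq mulrBr.
have vx : v x < 0 by rewrite vE pmulr_rlt0// subr_lt0.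
have vy : 0 < v y by rewrite vE pmulr_rgt0// subr_gt0.
pose m := Num.bound `|t / v y|.
have mt : t <= m%:R * v y.
  rewrite -ler_pdivrMr//; apply: le_trans (ler_norm _) _.
  by apply: ltW; exact: archi_boundP.
exists ((fun z => m%:R * v z) \max cst 0).
  by apply: (lsubgroup_max GC); [exact: lsubgroupMn|exact: (lsubgroup0 GC)].
split => /=; last by rewrite le_max mt.
by apply/max_idPr; rewrite mulr_ge0_le0// ltW.
Qed.

Lemma interpolate_two_points (x y : X) (g h : X -> R) :
  (exists2 u, G u & u x <> u y) -> G g -> G h ->
  exists2 k, G k & k x = g x /\ k y = h y.
Proof.
move=> sep Gg Gh; have GN := lsubgroupN GC; have GD := lsubgroupD GC.
have [p Gp [px py]] := vanishing_large `|h y - g y| sep.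
(* Truncating [h - g] between [- p] and [p] gives 0 where [p] vanishes and
   [h - g] where [p] dominates it. *)
exists (g \+ (((h \+ (\- g)) \min p) \max (\- p))).
  apply: (GD) => //; apply: (lsubgroup_max GC); last exact: GN.
  by apply: (lsubgroup_min GC) => //; apply: (GD) => //; exact: GN.
split => /=.
  by rewrite px oppr0 (max_idPr _) ?addr0// ge_min lexx orbT.
move: py; rewrite ler_norml => /andP[pl pu].
by rewrite (min_idPl pu) (max_idPl pl) addrC subrK.
Qed.

End Values.

Lemma sup_norm_le (R : realType) (X : aspace) (f : X -> R) (e : R) :
  (0 <= e)%R -> (forall x, `|f x| <= e)%R -> (sup_norm f <= e)%R.
Proof.
move=> e0 fe; rewrite /sup_norm.
have [->|/set0P ne] := eqVneq [set `|f x|%R | x in [set: X]] set0.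
  by rewrite sup0.
by apply: ge_sup => // _ [x _ <-].
Qed.

(** * Density *)

Theorem theorem7p7 (R : realType) (X : aspace) (G : set (X -> R))
    (cptX : compact [set: X]) (GC : unital_lsubgroup G)
    (Gsep : forall x y : X, x <> y -> exists2 g, G g & g x <> g y)
    (Glcm : forall x : X, zeta x = lcm_set [set den (g x) | g in G]) :
  uniformly_dense G.
Proof.
move=> f [cf df] e e0.
have e2 : (0 < e / 2)%R by rewrite divr_gt0.
have approx x : exists2 g, G g & (`|g x - f x| < e / 2)%R.
  exact: (values_approximate GC (Glcm x) (df x) e2).
have [|||||| g Gg gf] := @lattice_approximation R X cptX G f (e / 2).
- by exists (cst 0%R); exact: (lsubgroup0 GC).
- exact: (lsubgroup_min GC).
- exact: (lsubgroup_max GC).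
- exact: cf.
- by move=> g /(lsubgroup_Ca GC)[].
- move=> x y; have [gx Gx gxE] := approx x.
  have [<-|xy] := pselect (x = y); first by exists gx.
  have [gy Gy gyE] := approx y.
  have [k Gk [kx ky]] := interpolate_two_points GC (Gsep _ _ xy) Gx Gy.
  by exists k => //; rewrite kx ky.
exists g => //; apply: (@le_lt_trans _ _ (e / 2)%R); last first.
  by rewrite ltr_pdivrMr// ltr_pMr// ltr1n.
by apply: sup_norm_le => [|x]; [exact: ltW|rewrite distrC ltW].
Qed.
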